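(* Let $N = 2^L$ and $M \in \mathbb{N}$. For an integer $1 \le L_c \le L$ and ranks $r_0, \ldots, r_{L_c-1} \in \mathbb{N}_{>0}$, the truncated hierarchical decomposition with $L_c$ levels has parameters $\mathbf{a}^{0,j,\gamma} \in \mathbb{R}^M$ ($j\in[N]$, $\gamma\in[r_0]$), $\mathbf{a}^{l,j,\gamma} \in \mathbb{R}^{r_{l-1}}$ ($l \in [L_c-1]$, $j\in[N/2^l]$, $\gamma\in[r_l]$), and $\mathbf{a}^{L_c} \in \mathbb{R}^{r_{L_c-1}}$, and generates the order-$N$ tensor (dimension $M$ in each mode) $$\mathcal{A} = \sum_{\alpha=1}^{r_{L_c-1}} a^{L_c}_\alpha \bigotimes_{j=1}^{2^{L-L_c+1}} \phi^{L_c-1,j,\alpha},$$ where $\phi^{0,j,\alpha} := \mathbf{a}^{0,j,\alpha}$ and, for $1\le l\le L_c-1$, $\phi^{l,j,\gamma} = \sum_{\alpha=1}^{r_{l-1}} a^{l,j,\gamma}_\alpha\, \phi^{l-1,2j-1,\alpha} \otimes \phi^{l-1,2j,\alpha}$ (a tensor of order $2^l$). Let $L \ge L_1 > L_2 \ge 1$. Let $\mathcal{A}^{(1)}$ be generated by the truncated decomposition with $L_1$ levels and ranks $r^{(1)}_0,\ldots,r^{(1)}_{L_1-1}$, and define $r := \min\{r^{(1)}_0, \ldots, r^{(1)}_{L_2-1}, M\}$. Then in the Euclidean space of parameter configurations $\{\mathbf{a}^{(1),l,j,\gamma}\}_{l,j,\gamma}$ (together with $\mathbf{a}^{(1),L_1}$)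 of $\mathcal{A}^{(1)}$'s decomposition, the set of configurations for which there exist ranks $r^{(2)}_0,\ldots,r^{(2)}_{L_2-1}$ with $r^{(2)}_{L_2-1} < r^{2^{L-L_2}}$ and parameters of a truncated decomposition with $L_2$ levels and these ranks generating a tensor $\mathcal{A}^{(2)}$ equal to $\mathcal{A}^{(1)}$, has Lebesgue measure zero. The same holds if $\mathcal{A}^{(1)}$'s decomposition is constrained to be shared, i.e. $\mathbf{a}^{(1),l,j,\gamma} = \mathbf{a}^{(1),l,\gamma}$ for all $j$, and one considers the space of configurations of $\{\mathbf{a}^{(1),l,\gamma}\}_{l,\gamma}$ (together with $\mathbf{a}^{(1),L_1}$), while $\mathcal{A}^{(2)}$'s decomposition is unconstrained.
   Context: $[k]=\{1,\ldots,k\}$; $\otimes$ is the tensor product $(\mathcal{A}\otimes\mathcal{B})_{d_1\ldots d_{P+Q}}=\mathcal{A}_{d_1\ldots d_P}\mathcal{B}_{d_{P+1}\ldots d_{P+Q}}$, and $\bigotimes_{j=1}^k \mathcal{B}_j = \mathcal{B}_1\otimes\cdots\otimes\mathcal{B}_k$; $a_\alpha$ denotes entry $\alpha$ of vector $\mathbf{a}$. Measure is Lebesgue measure. *)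

(* Defs.v *)
From mathcomp Require Import all_boot all_order all_algebra.
From mathcomp Require Import reals.
Set Implicit Arguments. Unset Strict Implicit. Unset Printing Implicit Defensive.
Import Order.TTheory GRing.Theory Num.Theory.
Local Open Scope ring_scope.

Definition lebesgue_null (R : realType) (P : finType) (S : (P -> R) -> Prop) : Prop :=
  forall eps : R, 0 < eps ->
    exists lo hi : nat -> P -> R,
      (forall k p, lo k p <= hi k p) /\
      (forall x, S x -> exists k, forall p, lo k p <= x p <= hi k p) /\
      (forall n, \sum_(k < n) \prod_(p : P) (hi k p - lo k p) < eps).

(* Parameters of a truncated hierarchical decomposition with Lc levels,      *)
(* N = 2^L, mode dimension M, ranks r 0, ..., r (Lc-1).                      *)
(* A parameter is addressed by (l, j, g, a) (all 0-based):                   *)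
(*   l = 0      : a^{0,j,g}_a,  j < 2^L,       g < r 0, a < M                *)
(*   0 < l < Lc : a^{l,j,g}_a,  j < 2^(L-l),   g < r l, a < r (l-1)          *)
(*   l = Lc     : a^{Lc}_a,     (j = g = 0),            a < r (Lc-1)         *)
(* In the shared variant the node index j is absent (always 0).              *)
Definition valid (shared : bool) (L M Lc : nat) (r : nat -> nat)
    (l j g a : nat) : bool :=
  if l == 0%N then [&& (if shared then j == 0%N else j < 2 ^ L)%N, (g < r 0%N)%N & (a < M)%N]
  else if (l < Lc)%N then
    [&& (if shared then j == 0%N else j < 2 ^ (L - l))%N, (g < r l)%N & (a < r l.-1)%N]
  else [&& l == Lc, j == 0%N, g == 0%N & (a < r Lc.-1)%N].

Definition bnd (M Lc : nat) (r : nat -> nat) : nat :=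
  (maxn M (\max_(l < Lc) r l)).+1.

Definition coords (n1 n2 n3 : nat)
    (x : 'I_n1 * 'I_n2 * 'I_n3 * 'I_n3) : nat * nat * nat * nat :=
  let: (l, j, g, a) := x in (nat_of_ord l, nat_of_ord j, nat_of_ord g, nat_of_ord a).

Definition vpred (shared : bool) (L M Lc : nat) (r : nat -> nat)
    (x : 'I_Lc.+1 * 'I_(2 ^ L) * 'I_(bnd M Lc r) * 'I_(bnd M Lc r)) : bool :=
  let: (l, j, g, a) := coords x in valid shared L M Lc r l j g a.

Definition Pidx (shared : bool) (L M Lc : nat) (r : nat -> nat) : finType :=
  Finite.clone _ {x : 'I_Lc.+1 * 'I_(2 ^ L) * 'I_(bnd M Lc r) * 'I_(bnd M Lc r) |
     @vpred shared L M Lc r x}.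

(* The parameter a^{l,j,g}_a of configuration theta (0 for invalid addresses;
   in the shared variant j is ignored). *)
Definition param (R : realType) (shared : bool) (L M Lc : nat) (r : nat -> nat)
    (theta : Pidx shared L M Lc r -> R) (l j g a : nat) : R :=
  \sum_(p : Pidx shared L M Lc r |
          coords (val p) == (l, (if shared then 0 else j), g, a)) theta p.

(* phi^{l,j,g} : tensor of order 2^l; its entry at indices d 0, ..., d (2^l-1).
   phi^{l+1,j,g} = sum_a a^{l+1,j,g}_a phi^{l,2j,a} (x) phi^{l,2j+1,a}. *)
Fixpoint phi (R : realType) (A : nat -> nat -> nat -> nat -> R) (r : nat -> nat)
    (l j g : nat) (d : nat -> nat) {struct l} : R :=
  match l with
  | 0 => A 0%N j g (d 0%N)
  | l'.+1 => \sum_(a < r l')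
       A l'.+1 j g a * phi A r l' (2 * j)%N a d
                     * phi A r l' (2 * j).+1 a (fun i => d (i + 2 ^ l')%N)
  end.

Definition ext (L M : nat) (d : 'I_(2 ^ L) -> 'I_M) (i : nat) : nat :=
  match (insub i : option 'I_(2 ^ L)) with Some k => nat_of_ord (d k) | None => 0%N end.

Definition gen_tensor (R : realType) (A : nat -> nat -> nat -> nat -> R)
    (r : nat -> nat) (L M Lc : nat) (d : 'I_(2 ^ L) -> 'I_M) : R :=
  \sum_(a < r Lc.-1) A Lc 0%N 0%N a *
     \prod_(j < 2 ^ (L - Lc + 1)) phi A r Lc.-1 j a (fun i => ext d (j * 2 ^ Lc.-1 + i)%N).

Definition hdt (R : realType) (shared : bool) (L M Lc : nat) (r : nat -> nat)
    (theta : Pidx shared L M Lc r -> R) : ('I_(2 ^ L) -> 'I_M) -> R :=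
  @gen_tensor R (param theta) r L M Lc.

Definition min_rank (r1 : nat -> nat) (L2 M : nat) : nat :=
  \big[minn/M]_(l < L2) r1 l.

Definition bad_set (R : realType) (shared : bool) (L M L1 L2 : nat) (r1 : nat -> nat)
    (theta1 : Pidx shared L M L1 r1 -> R) : Prop :=
  exists r2 : nat -> nat,
    (forall l, (l < L2)%N -> (0 < r2 l)%N) /\
    (r2 L2.-1 < (min_rank r1 L2 M) ^ (2 ^ (L - L2)))%N /\
    exists theta2 : Pidx false L M L2 r2 -> R,
      forall d : 'I_(2 ^ L) -> 'I_M, hdt theta2 d = hdt theta1 d.

(* Main.v *)
(* Cut the modes into blocks of size 2^L2 and matricize: the first halves of the
   blocks index rows, the second halves index columns. A tensor with an L2-level
   decomposition of ranks r2 then has matrix rank at most r2(L2-1), so its minors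
   of size r^(2^(L-L2)) vanish. Such a minor is a polynomial in the parameters
   of A1, and it takes the value 1 at an explicit (shared) configuration. So the
   bad set lies in the zero set of a nonzero polynomial, which is null: at each
   zero some iterated partial derivative vanishes while one of its own partial
   derivatives does not, hence the zero set is a countable union of pieces of
   Lipschitz graphs. *)
Require Import Defs.
From mathcomp Require Import all_boot all_order all_algebra.
From mathcomp Require Import reals boolp ring lra zify.
Set Implicit Arguments. Unset Strict Implicit. Unset Printing Implicit Defensive.
Import Order.TTheory GRing.Theory Num.Theory.
Local Open Scope ring_scope.

(** * Null sets: countable unions and Lipschitz graphs *)

Lemma ler_sum_uniq (R : numDomainType) (T : finType) (s : seq T) (v : T -> R) :
  (forall t, 0 <= v t) -> uniq s -> \sum_(t <- s) v t <= \sum_t v t.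
Proof.
move=> v_ge0 us; rewrite big_uniq //= [leRHS](bigID [in s]) /=.
by rewrite lerDl sumr_ge0.
Qed.

Section NullSets.
Variables (R : realType) (P : finType).
Implicit Types (S : (P -> R) -> Prop) (i : P).

Lemma sub_lebesgue_null S S' :
  (forall x, S x -> S' x) -> lebesgue_null S' -> lebesgue_null S.
Proof.
move=> sSS' nS' e /nS' [lo [hi [le_lh [cov small]]]].
by exists lo, hi; split=> //; split=> // x /sSS'; apply: cov.
Qed.

Lemma box_volume_ge0 (lo hi : P -> R) :
  (forall p, lo p <= hi p) -> 0 <= \prod_p (hi p - lo p).
Proof. by move=> le_lh; apply: prodr_ge0 => p _; rewrite subr_ge0. Qed.

(* Boxes of volume zero pad the enumeration of a countable cover: this needs
   a coordinate [i], since every box in dimension zero has volume one. *)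
Lemma null_countable_cover i S :
  (forall eps : R, 0 < eps -> exists (T : countType) (lo hi : T -> P -> R),
      [/\ forall t p, lo t p <= hi t p,
          forall x, S x -> exists t, forall p, lo t p <= x p <= hi t p
        & forall s, uniq s -> \sum_(t <- s) \prod_p (hi t p - lo t p) < eps]) ->
  lebesgue_null S.
Proof.
move=> cover eps /cover [T [lo [hi [le_lh cov small]]]].
pose pad (f : T -> P -> R) k := oapp f (fun=> 0) (pickle_inv k).
exists (pad lo), (pad hi); split; [|split].
- by move=> k p; rewrite /pad; case: pickle_inv => //=.
- by move=> x /cov [t xt]; exists (pickle t) => p; rewrite /pad pickleK_inv /=.
move=> n; set v := fun t => \prod_p (hi t p - lo t p).
suff -> : \sum_(k < n) \prod_p (pad hi k p - pad lo k p)
    = \sum_(t <- pmap (@pickle_inv T) (iota 0 n)) v t.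
  by apply: small; apply: pmap_uniq (@pickle_invK T) _ (iota_uniq _ _).
rewrite -(big_mkord predT (fun k => \prod_p (pad hi k p - pad lo k p))).
rewrite /index_iota subn0; elim: (iota 0 n) => [|k s IHs] /=.
  by rewrite !big_nil.
rewrite big_cons {}IHs /pad; case: pickle_inv => [t|] /=.
  by rewrite big_cons.
by rewrite (bigD1 i) //= subrr mul0r add0r.
Qed.

Lemma null_empty i : lebesgue_null (fun _ : P -> R => False).
Proof.
apply: (null_countable_cover i) => eps eps_gt0.
by exists void, (fun=> fun=> 0), (fun=> fun=> 0); split=> // -[|[]//]; rewrite big_nil.
Qed.

Lemma sum_geometric_lt (eps : R) n :
  0 < eps -> \sum_(k < n) eps / 2 ^+ k.+1 < eps.
Proof.
move=> eps_gt0; suff -> : \sum_(k < n) eps / 2 ^+ k.+1 = eps - eps / 2 ^+ n.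
  by rewrite ltrBlDr ltrDl divr_gt0 // exprn_gt0.
elim: n => [|n IHn]; first by rewrite big_ord0 expr0 divr1 subrr.
rewrite big_ord_recr /= {}IHn exprS; field.
by rewrite expf_neq0 // pnatr_eq0.
Qed.

(** The k-th set gets the budget [eps / 2 ^+ k.+1]. A finite list of index pairs fits in a square,
    whose row sums are dominated by a geometric series. *)
Lemma null_bigcup_nat i (F : nat -> (P -> R) -> Prop) :
  (forall k, lebesgue_null (F k)) -> lebesgue_null (fun x => exists k, F k x).
Proof.
move=> nF; apply: (null_countable_cover i) => eps eps_gt0.
have /choice [b hb] k : exists b : (nat -> P -> R) * (nat -> P -> R),
    [/\ forall j p, b.1 j p <= b.2 j p,
        forall x, F k x -> exists j, forall p, b.1 j p <= x p <= b.2 j p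
      & forall n, \sum_(j < n) \prod_p (b.2 j p - b.1 j p) < eps / 2 ^+ k.+1].
  have e_gt0 : 0 < eps / 2 ^+ k.+1 by rewrite divr_gt0 // exprn_gt0.
  by have [lo [hi [? [? ?]]]] := nF k _ e_gt0; exists (lo, hi).
exists (nat * nat)%type, (fun t => (b t.1).1 t.2), (fun t => (b t.1).2 t.2).
split=> [t p|x [k Fkx]|s us].
- by have [] := hb t.1.
- by have [_ /(_ x Fkx) [j xj] _] := hb k; exists (k, j).
pose v (t : nat * nat) := \prod_p ((b t.1).2 t.2 p - (b t.1).1 t.2 p).
have v_ge0 t : 0 <= v t by apply: box_volume_ge0 => p; have [] := hb t.1.
pose B := (\max_(t <- s) maxn t.1 t.2).+1.
have sB t : t \in s -> (t.1 < B)%N && (t.2 < B)%N.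
  by move=> ts; rewrite !ltnS -geq_max; exact: (@leq_bigmax_seq _ s predT (fun t => maxn t.1 t.2)).
apply: (@le_lt_trans _ _ (\sum_(k < B) \sum_(j < B) v ((k : nat), (j : nat)))); last first.
  apply: le_lt_trans (sum_geometric_lt B eps_gt0); apply: ler_sum => k _.
  by have [_ _ /(_ B)/ltW] := hb k.
pose g (t : nat * nat) : 'I_B * 'I_B := (inord t.1, inord t.2).
have gK t : t \in s -> v t = v ((g t).1 : nat, (g t).2 : nat).
  by move=> /sB /andP[? ?]; rewrite /= !inordK //; case: t.
rewrite pair_big /= (eq_big_seq _ gK).
rewrite -(big_map g predT (fun u : 'I_B * 'I_B => v (u.1 : nat, u.2 : nat))).
apply: ler_sum_uniq => //; rewrite map_inj_in_uniq // => t u /sB/andP[? ?] /sB/andP[? ?].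
move=> /(congr1 (fun w : 'I_B * 'I_B => (w.1 : nat, w.2 : nat))) /=.
by rewrite !inordK // -!surjective_pairing.
Qed.

Lemma null_bigcup i (T : countType) (F : T -> (P -> R) -> Prop) :
  (forall t, lebesgue_null (F t)) -> lebesgue_null (fun x => exists t, F t x).
Proof.
move=> nF.
pose G k x := if pickle_inv k is Some t then F t x else False.
apply: (@sub_lebesgue_null _ (fun x => exists k, G k x)).
  by move=> x [t Ftx]; exists (pickle t); rewrite /G pickleK_inv.
apply: (null_bigcup_nat i) => k; rewrite /G.
by case: pickle_inv => // *; apply: null_empty i.
Qed.

Lemma grid_cell (K t : R) N : 0 < K -> `|t| < K ->
  exists j : 'I_N.+1, let h := 2 * K / N.+1%:R in
    - K + j%:R * h <= t <= - K + j.+1%:R * h.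
Proof.
move=> K_gt0; rewrite ltr_norml => /andP[ltKt lttK].
have N_gt0 : 0 < N.+1%:R :> R by [].
pose h := 2 * K / N.+1%:R.
have h_gt0 : 0 < h by rewrite divr_gt0 // mulr_gt0.
have u_ge0 : 0 <= (t + K) / h by rewrite divr_ge0 ?ltW //; lra.
have ltjN : (Num.truncn ((t + K) / h) < N.+1)%N.
  by rewrite truncn_lt_nat // ltr_pdivrMr // /h mulrCA divff ?gt_eqF // mulr1; lra.
exists (Ordinal ltjN) => /=; rewrite -/h.
have := truncn_itv u_ge0; rewrite ler_pdivlMr // ltr_pdivrMr //.
by move=> /andP[? ?]; apply/andP; split; lra.
Qed.

(* Over each cell of a grid of mesh [h] in the coordinates other than [i], the
   set [S] is contained in a box of height [2 C h]. *)
Lemma null_lipschitz_graph i (K C : R) S : 0 < K -> 0 <= C ->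
  (forall x, S x -> forall p, `|x p| < K) ->
  (forall (h : R) y z, 0 <= h -> S y -> S z ->
     (forall k, k != i -> `|y k - z k| <= h) -> `|y i - z i| <= C * h) ->
  lebesgue_null S.
Proof.
move=> K_gt0 C_ge0 bndS lipS; apply: (null_countable_cover i) => eps eps_gt0.
(* The [N.+1 ^ (#|P| - 1)] cells carry boxes of volume at most [2 * C * h * h ^ (#|P| - 1)], in
   total [V / N.+1]; [N] makes this less than [eps]. *)
pose V := 2 * C * \prod_(p : P) (2 * K).
have V_ge0 : 0 <= V by rewrite !mulr_ge0 // prodr_ge0 // => *; lra.
pose N := Num.truncn (V / eps).
have ltV : V < eps * N.+1%:R by rewrite mulrC -ltr_pdivrMr // truncnS_gt.
pose h := 2 * K / N.+1%:R.
have h_ge0 : 0 <= h by rewrite divr_ge0 //; lra.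
pose cell (w : {ffun P -> 'I_N.+1}) (x : P -> R) := forall k, k != i ->
  - K + (w k)%:R * h <= x k <= - K + (w k).+1%:R * h.
(* In direction [i] only index 0 counts, so the sum over all [w] factors into sums over single
   coordinates without subdividing coordinate [i]. *)
pose F p (j : 'I_N.+1) := if p != i then h else if j == ord0 then 2 * (C * h) else 0.
have F_ge0 p j : 0 <= F p j by rewrite /F; case: ifP => // _; case: ifP => // _; rewrite mulr_ge0 // mulr_ge0.
have /choice [b hb] (w : {ffun P -> 'I_N.+1}) : exists b : (P -> R) * (P -> R),
    [/\ forall p, b.1 p <= b.2 p,
        forall x, S x -> cell w x -> w i = ord0 -> forall p, b.1 p <= x p <= b.2 p
      & \prod_p (b.2 p - b.1 p) <= \prod_p F p (w p)].
  (* A cell that meets [S] gets a box centred, in direction [i], at a point [y] of [S]; the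
     Lipschitz bound keeps the rest of [S] over this cell inside. Otherwise the box is
     degenerate. *)
  have [[y [Sy [wy wi]]]|no_y] := pselect (exists y, S y /\ cell w y /\ w i = ord0).
    exists (fun p => if p != i then - K + (w p)%:R * h else y i - C * h,
            fun p => if p != i then - K + (w p).+1%:R * h else y i + C * h).
    split=> /= [p|x Sx wx _ p|].
    - case: ifP => _; last by have := mulr_ge0 C_ge0 h_ge0; lra.
      by rewrite -[(w p).+1]addn1 natrD mulrDl; lra.
    - case: ifPn => [/wx //|/negPn/eqP ->].
      suff : `|y i - x i| <= C * h by rewrite ler_norml => /andP[? ?]; lra.
      apply: lipS => // k ki; have := wx k ki; have := wy k ki.
      rewrite -[(w k).+1]addn1 natrD mulrDl ler_norml => /andP[? ?] /andP[? ?].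
      by apply/andP; split; lra.
    apply: ler_prod => p _; rewrite /F; case: ifPn => [_|/negPn/eqP ->].
      by rewrite -[(w p).+1]addn1 natrD mulrDl; apply/andP; split; lra.
    by rewrite wi eqxx; have := mulr_ge0 C_ge0 h_ge0; lra.
  exists (fun=> 0, fun=> 0); split=> //= [x Sx wx wi|].
    by case: no_y; exists x.
  by rewrite (bigD1 i) //= subrr mul0r prodr_ge0.
exists {ffun P -> 'I_N.+1}, (fun w => (b w).1), (fun w => (b w).2).
split=> [w p|x Sx|s us]; first by have [] := hb w.
  have /choice [w hw] p := grid_cell N K_gt0 (bndS x Sx p).
  exists [ffun p => if p == i then ord0 else w p].
  have [_ /(_ x Sx) H _] := hb [ffun p => if p == i then ord0 else w p].
  apply: H; last by rewrite ffunE eqxx.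
  by move=> k ki; rewrite ffunE (negPf ki); apply: hw.
apply: le_lt_trans (ler_sum_uniq _ us) _.
  by move=> w; apply: box_volume_ge0; have [] := hb w.
apply: (@le_lt_trans _ _ (\sum_(w : {ffun P -> 'I_N.+1}) \prod_p F p (w p))).
  by apply: ler_sum => w _; have [] := hb w.
rewrite -bigA_distr_bigA /= (bigD1 i) //=.
have -> : \sum_(j < N.+1) F i j = 2 * (C * h).
  rewrite (bigD1 ord0) //= /F !eqxx /= big1 ?addr0 // => j /negPf ->.
  by [].
rewrite (eq_bigr (fun=> 2 * K)); last first.
  move=> p pi; rewrite /F pi sumr_const card_ord -[LHS]mulr_natr /h -mulrA.
  by rewrite mulVf ?mulr1 // pnatr_eq0.
suff -> : 2 * (C * h) * \prod_(p | p != i) (2 * K) = V / N.+1%:R.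
  by rewrite ltr_pdivrMr.
rewrite /V [in RHS](bigD1 i) //= /h; field.
by rewrite nat1r pnatr_eq0.
Qed.

End NullSets.

(** * Zero sets of polynomials, represented by syntax trees *)

Section PolynomialExpressions.
Variable R : realType.

Inductive expr (P : Type) : Type :=
  | Const of R
  | Var of P
  | Add of expr P & expr P
  | Mul of expr P & expr P.

Arguments Const {P}.

Fixpoint eval (P : Type) (e : expr P) (x : P -> R) : R :=
  match e with
  | Const c => c
  | Var p => x p
  | Add a b => eval a x + eval b x
  | Mul a b => eval a x * eval b x
  end.

Fixpoint rename (P Q : Type) (f : P -> Q) (e : expr P) : expr Q :=
  match e with
  | Const c => Const c
  | Var p => Var (f p)
  | Add a b => Add (rename f a) (rename f b)
  | Mul a b => Mul (rename f a) (rename f b)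
  end.

Lemma eval_rename (P Q : Type) (f : P -> Q) (e : expr P) (x : Q -> R) :
  eval (rename f e) x = eval e (fun p => x (f p)).
Proof. by elim: e => //= a -> b ->. Qed.

Fixpoint der (P : eqType) (k : P) (e : expr P) : expr P :=
  match e with
  | Const _ => Const 0
  | Var p => Const (p == k)%:R
  | Add a b => Add (der k a) (der k b)
  | Mul a b => Add (Mul a (der k b)) (Mul (der k a) b)
  end.

(* Difference quotients as polynomials in two copies of the variables. *)
Fixpoint quot (P : eqType) (k : P) (e : expr P) : expr (P + P) :=
  match e with
  | Const _ => Const 0
  | Var p => Const (p == k)%:R
  | Add a b => Add (quot k a) (quot k b)
  | Mul a b => Add (Mul (rename inl a) (quot k b)) (Mul (quot k a) (rename inr b))
  end.

Definition join (P : Type) (y z : P -> R) (u : P + P) : R :=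
  match u with inl p => y p | inr p => z p end.

Lemma eval_quot_diag (P : eqType) (k : P) (e : expr P) (x : P -> R) :
  eval (quot k e) (join x x) = eval (der k e) x.
Proof. by elim: e => //= a -> b ->; rewrite ?eval_rename. Qed.

(** Hadamard's formula. A product telescopes as [a(y) (b(y) - b(z)) + (a(y) - a(z)) b(z)], which is
    why [quot] reads the left factor at [y] and the right one at [z]. *)
Lemma eval_sub (P : finType) (e : expr P) (y z : P -> R) :
  eval e y - eval e z = \sum_k (y k - z k) * eval (quot k e) (join y z).
Proof.
elim: e => [c|p|a IHa b IHb|a IHa b IHb] /=.
- by rewrite subrr big1 // => k _; rewrite mulr0.
- rewrite (bigD1 p) //= eqxx mulr1 big1 ?addr0 // => k /negPf kp.
  by rewrite eq_sym kp mulr0.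
- rewrite opprD addrACA IHa IHb -big_split /=.
  by apply: eq_bigr => k _; rewrite mulrDr.
transitivity (eval a y * (eval b y - eval b z) + (eval a y - eval a z) * eval b z).
  by ring.
rewrite IHa IHb mulr_sumr mulr_suml -big_split /=.
by apply: eq_bigr => k _; rewrite !eval_rename /=; ring.
Qed.

Lemma eval_bounded (P : finType) (e : expr P) (K : R) :
  exists2 B : R, 0 <= B &
    forall x, (forall p, `|x p| <= K) -> `|eval e x| <= B.
Proof.
elim: e => [c|p|a [A A0 hA] b [B B0 hB]|a [A A0 hA] b [B B0 hB]] /=.
- by exists `|c|.
- by exists `|K| => // x /(_ p) xK; apply: le_trans xK (ler_norm _).
- exists (A + B) => [|x xK]; first exact: addr_ge0.
  by apply: le_trans (ler_normD _ _) _; rewrite lerD ?hA ?hB.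
- exists (A * B) => [|x xK]; first exact: mulr_ge0.
  by rewrite normrM ler_pM ?hA ?hB.
Qed.

Lemma eval_quot_bounded (P : finType) (e : expr P) (K : R) :
  exists2 B : R, 0 <= B &
    forall k y z, (forall p, `|y p| <= K) -> (forall p, `|z p| <= K) ->
      `|eval (quot k e) (join y z)| <= B.
Proof.
have /choice [B hB] k : exists B : R, 0 <= B /\ forall x,
    (forall p, `|x p| <= K) -> `|eval (quot k e) x| <= B.
  by have [B B0 hB] := eval_bounded (quot k e) K; exists B.
exists (\sum_k B k) => [|k y z yK zK]; first by apply: sumr_ge0 => k _; case: (hB k).
apply: (@le_trans _ _ (B k)); first by apply: (hB k).2; case.
by rewrite (bigD1 k) //= lerDl sumr_ge0 // => j _; case: (hB j).
Qed.

Lemma eval_lipschitz (P : finType) (e : expr P) (K : R) :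
  exists2 C : R, 0 <= C & forall (h : R) y z,
    (forall p, `|y p| <= K) -> (forall p, `|z p| <= K) ->
    (forall p, `|y p - z p| <= h) -> `|eval e y - eval e z| <= C * h.
Proof.
have [B B0 hB] := eval_quot_bounded e K.
exists (#|P|%:R * B) => [|h y z yK zK yz]; first exact: mulr_ge0.
rewrite eval_sub; apply: le_trans (ler_norm_sum _ _ _) _.
apply: (@le_trans _ _ (\sum_(k : P) B * h)).
  by apply: ler_sum => k _; rewrite normrM mulrC ler_pM ?hB.
by rewrite sumr_const -mulrA mulr_natl.
Qed.

Definition ders (P : eqType) (s : seq P) (e : expr P) : expr P := foldr (@der P) e s.

(** Restriction to the line [x + t v]: a univariate polynomial, hence determined by its derivatives
    at 0. *)
Fixpoint line (P : Type) (x v : P -> R) (e : expr P) : {poly R} :=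
  match e with
  | Const c => c%:P
  | Var p => (x p)%:P + v p *: 'X
  | Add a b => line x v a + line x v b
  | Mul a b => line x v a * line x v b
  end.

Lemma horner_line (P : Type) (x v : P -> R) (e : expr P) (t : R) :
  (line x v e).[t] = eval e (fun p => x p + v p * t).
Proof.
by elim: e => [c|p|a IHa b IHb|a IHa b IHb] /=; rewrite ?hornerE ?IHa ?IHb.
Qed.

(** Chain rule along the line. *)
Lemma deriv_line (P : finType) (x v : P -> R) (e : expr P) :
  (line x v e)^`() = \sum_p v p *: line x v (der p e).
Proof.
elim: e => [c|p|a IHa b IHb|a IHa b IHb] /=.
- by rewrite derivC big1 // => p _; rewrite polyC0 scaler0.
- rewrite derivD derivC add0r derivZ derivX (bigD1 p) //= eqxx big1 ?addr0 //.
  by move=> k /negPf kp; rewrite eq_sym kp polyC0 scaler0.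
- rewrite derivD IHa IHb -big_split /=.
  by apply: eq_bigr => p _; rewrite scalerDr.
rewrite derivM IHa IHb mulr_suml mulr_sumr -big_split /=.
by apply: eq_bigr => p _; rewrite scalerDr -scalerAl -scalerAr addrC.
Qed.

(** By the chain rule, the restriction to the line from [x] to [y] has all derivatives zero at 0, so
    it is the zero polynomial; its value at 1 is [eval e y]. *)
Lemma ders_eq0 (P : finType) (e : expr P) (x : P -> R) :
  (forall s, eval (ders s e) x = 0) -> forall y, eval e y = 0.
Proof.
move=> ders0 y; pose v p := y p - x p.
have line0 n : (line x v e)^`(n).[0] = 0.
  elim: n e ders0 => [|n IHn] e ders0.
    rewrite horner_line -[RHS](ders0 [::]) /=; congr eval.
    by apply/funext => p; rewrite mulr0 addr0.
  rewrite derivSn deriv_line linear_sum horner_sum big1 //= => p _.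
  rewrite linearZ hornerZ IHn ?mulr0 // => s.
  (* [foldr] applies the last entry of the list first. *)
  by rewrite -[RHS](ders0 (rcons s p)) /ders foldr_rcons.
have line_eq0 : line x v e = 0.
  apply/polyP => n; rewrite coef0; apply/eqP.
  (* The derivative of order [n] at 0 is the coefficient times a factorial, which is nonzero in
     [R]. *)
  have := line0 n; rewrite horner_coef0 coef_derivn addn0 ffactnn => /eqP.
  by rewrite mulrn_eq0 -leqn0 leqNgt fact_gt0.
have := horner_line x v e 1; rewrite line_eq0 horner0 => ->; congr eval.
by apply/funext => p; rewrite /v mulr1 addrC subrK.
Qed.

(** Otherwise induction on the list spreads the vanishing at [x] from [e] to all iterated
    derivatives, and [ders_eq0] makes [e] zero everywhere. *)
Lemma root_noncritical_ders (P : finType) (e : expr P) (x y : P -> R) :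
  eval e x = 0 -> eval e y != 0 ->
  exists s i, eval (ders s e) x = 0 /\ eval (der i (ders s e)) x != 0.
Proof.
move=> ex0 ey0; apply: contrapT => noncrit; case/eqP: ey0.
apply: (ders_eq0 (x := x)); elim=> [|i s IHs] //=.
by apply: contrapT => /eqP ?; apply: noncrit; exists s, i.
Qed.

(* On a small cube where [|der i e| >= c], Hadamard's formula [eval_sub] shows
   that the zero set is a Lipschitz graph over the other coordinates. *)
Lemma null_noncritical_zeros (P : finType) (e : expr P) (i : P) :
  lebesgue_null (fun x => eval e x = 0 /\ eval (der i e) x != 0).
Proof.
(* The sets [S n] exhaust the noncritical zeros; on each, points are bounded and the derivative
   stays away from 0. *)
pose S n (x : P -> R) := [/\ forall p, `|x p| < n.+1%:R, eval e x = 0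
  & n.+1%:R^-1 <= `|eval (der i e) x|].
apply: (@sub_lebesgue_null _ _ _ (fun x => exists n, S n x)).
  move=> x [ex0 dx0]; pose n := Num.truncn (\sum_p `|x p| + `|eval (der i e) x|^-1).
  have := truncnS_gt (\sum_p `|x p| + `|eval (der i e) x|^-1); rewrite -/n => ltn.
  exists n; split=> // [p|].
    apply: le_lt_trans ltn; rewrite (bigD1 p) //= -addrA lerDl addr_ge0 ?invr_ge0 //.
    by rewrite sumr_ge0.
  rewrite -[leRHS]invrK lef_pV2 ?posrE ?invr_gt0 ?normr_gt0 //.
  by apply/ltW/(le_lt_trans _ ltn); rewrite lerDr sumr_ge0.
apply: (null_bigcup i) => n; set K : R := n.+1%:R.
have K_gt0 : 0 < K by [].
have [B B0 hB] := eval_quot_bounded e K.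
have [C C0 hC] := eval_lipschitz (quot i e) K.
(* On cubes of side [1 / m] the difference quotient is within [C / m <= 1 / (2K)] of the derivative,
   so it keeps half of the lower bound [1 / K]. *)
pose m := (Num.truncn (2 * K * C)).+1.
have m_gt : 2 * K * C < m%:R by apply: truncnS_gt.
have m_gt0 : 0 < m%:R :> R by [].
pose cube (c : {ffun P -> int}) (x : P -> R) := S n x /\ forall p, c p = Num.floor (x p * m%:R).
apply: (@sub_lebesgue_null _ _ _ (fun x => exists c, cube c x)).
  by move=> x Sx; exists [ffun p => Num.floor (x p * m%:R)]; split=> // p; rewrite ffunE.
apply: (null_bigcup i) => c.
apply: (@null_lipschitz_graph _ _ i K (2 * K * (#|P|%:R * B))) => //.
- by rewrite !mulr_ge0 // ltW.
- by move=> x [[]].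
move=> h y z h_ge0 [[yK ey0 dy] cy] [[zK ez0 _] cz] yz.
have yK' p : `|y p| <= K by apply/ltW/yK.
have zK' p : `|z p| <= K by apply/ltW/zK.
have close p : `|y p - z p| <= m%:R^-1.
  have := floor_itv (y p * m%:R); have := floor_itv (z p * m%:R).
  rewrite -cy -cz intrD => /andP[? ?] /andP[? ?].
  rewrite -[_^-1]mul1r ler_pdivlMr // -[m%:R in leLHS]ger0_norm // -normrM.
  by rewrite ler_norml; apply/andP; split; lra.
have quot_large : (2 * K)^-1 <= `|eval (quot i e) (join y z)|.
  have : `|eval (quot i e) (join y y) - eval (quot i e) (join y z)| <= C / m%:R.
    by apply: hC => -[]p //=; rewrite subrr normr0 invr_ge0.
  have : C / m%:R <= (2 * K)^-1.
    by rewrite ler_pdivrMr // mulrC ler_pdivlMr ?mulr_gt0 // mulrC ltW.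
  rewrite eval_quot_diag => Cm_le /le_trans/(_ Cm_le).
  have := lerB_dist (eval (der i e) y) (eval (quot i e) (join y z)).
  have : (2 * K)^-1 = K^-1 / 2 by rewrite invfM mulrC.
  move: dy; rewrite -/K; move: (K^-1) ((2 * K)^-1) => u v; lra.
(* Both values vanish, so the term of index [i] in Hadamard's formula balances the others;
   [quot_large] then bounds [y i - z i]. *)
have := eval_sub e y z; rewrite ey0 ez0 subrr (bigD1 i) //= => /esym/eqP.
rewrite addr_eq0 => /eqP /(congr1 Num.norm); rewrite normrM normrN => yz_i.
have rest : `|\sum_(k | k != i) (y k - z k) * eval (quot k e) (join y z)| <= #|P|%:R * B * h.
  apply: le_trans (ler_norm_sum _ _ _) _.
  apply: (@le_trans _ _ (\sum_(k : P) B * h)); last first.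
    by rewrite sumr_const -mulrA mulr_natl.
  rewrite [leRHS](bigD1 i) //= -[leLHS]add0r lerD ?mulr_ge0 //.
  by apply: ler_sum => k ki; rewrite normrM mulrC ler_pM ?hB ?yz.
have : `|y i - z i| * (2 * K)^-1 <= #|P|%:R * B * h.
  by apply: le_trans rest; rewrite -yz_i ler_wpM2l.
by rewrite ler_pdivrMr ?mulr_gt0 //; lra.
Qed.

(** Each zero is a noncritical zero of some iterated derivative, and there are countably many
    choices of the list and the variable. *)
Lemma null_zeros (P : finType) (e : expr P) (i : P) (x : P -> R) :
  eval e x != 0 -> lebesgue_null (fun y => eval e y = 0).
Proof.
move=> ex0; pose F (t : seq P * P) y :=
  eval (ders t.1 e) y = 0 /\ eval (der t.2 (ders t.1 e)) y != 0.
apply: (@sub_lebesgue_null _ _ _ (fun y => exists t, F t y)).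
  by move=> y /root_noncritical_ders /(_ ex0) [s [j hsj]]; exists (s, j).
by apply: (null_bigcup i) => t; apply: null_noncritical_zeros.
Qed.

(** Only the existence of a tree is kept, so that tensor entries and minors are handled by closure
    properties. *)
Definition polyfun (P : Type) (f : (P -> R) -> R) : Prop :=
  exists e : expr P, forall x, eval e x = f x.

Variable P : finType.
Implicit Types f g : (P -> R) -> R.

Lemma polyfun_const c : polyfun (fun _ : P -> R => c).
Proof. by exists (Const c). Qed.

Lemma polyfun_var (p : P) : polyfun (fun x => x p).
Proof. by exists (Var p). Qed.

Lemma polyfunM f g : polyfun f -> polyfun g -> polyfun (fun x => f x * g x).
Proof. by move=> [a ha] [b hb]; exists (Mul a b) => x /=; rewrite ha hb. Qed.

Lemma polyfun_sum I (r : seq I) (Q : pred I) (F : I -> (P -> R) -> R) :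
  (forall i, polyfun (F i)) -> polyfun (fun x => \sum_(i <- r | Q i) F i x).
Proof.
move=> polyF; elim: r => [|i r [e he]].
  by exists (Const 0) => x; rewrite big_nil.
have [a ha] := polyF i; exists (if Q i then Add a e else e) => x.
by rewrite big_cons; case: ifP => _ /=; rewrite he ?ha.
Qed.

Lemma polyfun_prod I (r : seq I) (Q : pred I) (F : I -> (P -> R) -> R) :
  (forall i, polyfun (F i)) -> polyfun (fun x => \prod_(i <- r | Q i) F i x).
Proof.
move=> polyF; elim: r => [|i r [e he]].
  by exists (Const 1) => x; rewrite big_nil.
have [a ha] := polyF i; exists (if Q i then Mul a e else e) => x.
by rewrite big_cons; case: ifP => _ /=; rewrite he ?ha.
Qed.

Lemma polyfun_det n (A : (P -> R) -> 'M[R]_n) :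
  (forall i j, polyfun (fun x => A x i j)) -> polyfun (fun x => \det (A x)).
Proof.
move=> polyA; apply: polyfun_sum => s; apply: polyfunM; first exact: polyfun_const.
by apply: polyfun_prod => i; apply: polyA.
Qed.

Lemma null_polyfun_zeros f (i : P) (x : P -> R) :
  polyfun f -> f x != 0 -> lebesgue_null (fun y => f y = 0).
Proof.
move=> [e he]; rewrite -he => /(null_zeros i).
by apply: sub_lebesgue_null => y; rewrite he.
Qed.

End PolynomialExpressions.

(** * Tensor entries as polynomials in the parameters *)

Section Decompositions.
Variable R : realType.

(** Index functions are total on [nat]; this permits changing them outside the [2 ^ l] places that
    [phi] reads. *)
Lemma eq_phi (A : nat -> nat -> nat -> nat -> R) r l j g (d d' : nat -> nat) :
  (forall i, (i < 2 ^ l)%N -> d i = d' i) -> phi A r l j g d = phi A r l j g d'.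
Proof.
elim: l j g d d' => [|l IHl] j g d d' dd' /=; first by rewrite dd'.
apply: eq_bigr => a _; congr (_ * _ * _); apply: IHl => i ltil; apply: dd'.
  by rewrite expnS mul2n -addnn ltn_addr.
by rewrite expnS mul2n -addnn ltn_add2r.
Qed.

Lemma phiS (A : nat -> nat -> nat -> nat -> R) r l j g d :
  phi A r l.+1 j g d = \sum_(a < r l) A l.+1 j g a * phi A r l (2 * j)%N a d
    * phi A r l (2 * j).+1 a (fun i => d (i + 2 ^ l)%N).
Proof. by []. Qed.

Section PolynomialTensor.
Variables (shared : bool) (L M L1 : nat) (r1 : nat -> nat).
Local Notation config := (Pidx shared L M L1 r1 -> R).

Lemma polyfun_param l j g a : polyfun (fun theta : config => param theta l j g a).
Proof. by apply: polyfun_sum => p; apply: polyfun_var. Qed.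

Lemma polyfun_phi l j g d : polyfun (fun theta : config => phi (param theta) r1 l j g d).
Proof.
elim: l j g d => [|l IHl] j g d /=; first exact: polyfun_param.
by apply: polyfun_sum => a; do 2?[apply: polyfunM]; rewrite ?IHl //; apply: polyfun_param.
Qed.

Lemma polyfun_hdt d : polyfun (fun theta : config => hdt theta d).
Proof.
apply: polyfun_sum => a; apply: polyfunM; first exact: polyfun_param.
by apply: polyfun_prod => j; apply: polyfun_phi.
Qed.

End PolynomialTensor.

(** * Matricization by half blocks, with [k.+1] in the role of [L2] *)

Section Matricization.
Variables L k : nat.
Hypothesis ltkL : (k < L)%N.
Local Notation n := (2 ^ (L - k.+1))%N.

Lemma block_subproof (i : 'I_(2 ^ L)) : (i %/ 2 ^ k.+1 < n)%N.
Proof. by rewrite ltn_divLR ?expn_gt0 // -expnD subnK. Qed.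

Definition block i : 'I_n := Ordinal (block_subproof i).

(* The modes are cut into blocks of size 2^(k+1); the first half of block q
   carries the index [u q], the second half the index [v q]. *)
Definition mix M (u v : 'I_n -> 'I_M) (i : 'I_(2 ^ L)) : 'I_M :=
  if odd (i %/ 2 ^ k) then v (block i) else u (block i).

(** The half block numbered [b + q.*2] has parity [b], which [mix] tests, and lies in block [q]. *)
Lemma ext_mix M (u v : 'I_n -> 'I_M) (q : 'I_n) (b : bool) i : (i < 2 ^ k)%N ->
  ext (mix u v) ((b + q.*2) * 2 ^ k + i) = if b then v q else u q.
Proof.
move=> ltik; have ltiL : ((b + q.*2) * 2 ^ k + i < 2 ^ L)%N.
  have -> : (2 ^ L = n.*2 * 2 ^ k)%N.
    by rewrite -mul2n -expnS -expnD; congr (2 ^ _)%N; lia.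
  apply: (@leq_trans ((b + q.*2).+1 * 2 ^ k)%N); first by rewrite mulSn addnC ltn_add2r.
  by rewrite leq_mul2r; apply/orP; right; have := ltn_ord q; case: b; lia.
rewrite /ext insubT /mix /=.
rewrite divnMDl ?expn_gt0 // (divn_small ltik) addn0 oddD odd_double addbF oddb.
suff -> : block (Ordinal ltiL) = q by case: b {ltiL}.
apply: val_inj; rewrite /= expnSr divnMA divnMDl ?expn_gt0 // (divn_small ltik) addn0.
by rewrite divn2 half_bit_double.
Qed.

(** Separates the variables: even half blocks see only [u], odd ones only [v]. Past [2 ^ L] both
    sides are the default 0 of [ext]. *)
Lemma ext_mix_parity M (u v : 'I_n -> 'I_M) x :
  ext (mix u v) x = if odd (x %/ 2 ^ k) then ext (mix v v) x else ext (mix u u) x.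
Proof.
rewrite /ext; case: insubP => [i _ <-|_]; last by case: ifP.
by rewrite /mix; case: ifP.
Qed.

(** At level [k] each factor [phi] reads one half block, so it depends on the row alone or on the
    column alone. Grouping the factors by the parity of [j] factors the matrix through dimension
    [r2 k]. *)
Lemma det_matricization_eq0 A r2 M m (w : 'I_m -> 'I_n -> 'I_M) : (r2 k < m)%N ->
  \det (\matrix_(f < m, g < m) @gen_tensor R A r2 L M k.+1 (mix (w f) (w g))) = 0.
Proof.
move=> ltm; apply/eqP; apply: contraTT ltm => det_neq0; rewrite -leqNgt.
pose part (b : bool) (f : 'I_m) (a : 'I_(r2 k)) : R :=
  \prod_(j < 2 ^ (L - k.+1 + 1) | odd j == b)
     phi A r2 k j a (fun i => ext (mix (w f) (w f)) (j * 2 ^ k + i)).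
pose U := \matrix_(f, a) (A k.+1 0%N 0%N a * part false f a).
pose V := \matrix_(a, g) part true g a.
set X := \matrix_(f, g) _ in det_neq0.
have defX : X = U *m V.
  apply/matrixP => f g; rewrite !mxE; apply: eq_bigr => a _; rewrite !mxE -mulrA.
  congr (_ * _); rewrite (bigID (fun j : 'I__ => odd j)) /= mulrC.
  congr (_ * _); rewrite /part; apply: eq_big => j; rewrite ?eqbF_neg ?eqb_id //.
    move=> /negPf jodd; apply: eq_phi => i ltik.
    by rewrite ext_mix_parity divnMDl ?expn_gt0 // divn_small // addn0 jodd.
  move=> jodd; apply: eq_phi => i ltik.
  by rewrite ext_mix_parity divnMDl ?expn_gt0 // divn_small // addn0 jodd.
have : X \in unitmx by rewrite unitmxE unitfE.
rewrite -row_free_unit => /eqP rkX; rewrite -[leqLHS]rkX defX.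
exact: leq_trans (mxrankM_maxr _ _) (rank_leq_row _).
Qed.

(* Parameters for which the matricization of the tensor is an identity matrix. *)
Definition witness (l g a : nat) : R :=
  if (l <= k)%N then (g == a)%:R else if l == k.+1 then 1 else (a == 0%N)%:R.

Lemma witness_high l g a : (k.+1 < l)%N -> witness l g a = (a == 0%N)%:R.
Proof. by move=> ltkl; rewrite /witness !ifF //; lia. Qed.

(** * The tensor at the witness parameters *)

Section Witness.
Variables (A : nat -> nat -> nat -> nat -> R) (M L1 r : nat) (r1 : nat -> nat).
Hypotheses (leL1L : (L1 <= L)%N) (ltkL1 : (k.+1 < L1)%N).
Hypothesis r1_gt0 : forall l, (l < L1)%N -> (0 < r1 l)%N.
Hypothesis ler_r1 : forall l, (l <= k)%N -> (r <= r1 l)%N.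
Hypothesis lerM : (r <= M)%N.
Hypothesis witA : forall l j g a, (l < L1)%N -> (j < 2 ^ (L - l))%N -> (g < r1 l)%N ->
  (a < if l is l'.+1 then r1 l' else M)%N -> A l j g a = witness l g a.
Hypothesis witA_top : forall a, (a < r1 L1.-1)%N -> A L1 0%N 0%N a = witness L1 0 a.

Lemma ltn_children l j : (l.+1 < L1)%N -> (j < 2 ^ (L - l.+1))%N ->
  ((2 * j).+1 < 2 ^ (L - l))%N.
Proof.
move=> ltlL1; have -> : (L - l = (L - l.+1).+1)%N by lia.
by rewrite expnS; lia.
Qed.

(** Identity weights turn index [g < r] into a tensor power of the [g]-th basis vector. As [c < r],
    the index [c] exists at every level up to [k], and only the summand [a = c] survives. *)
Lemma phi_witness_low l j g d c : (l <= k)%N -> (j < 2 ^ (L - l))%N -> (g < r1 l)%N ->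
  (c < r)%N -> (forall i, (i < 2 ^ l)%N -> d i = c) ->
  phi A r1 l j g d = (g == c)%:R.
Proof.
elim: l j g d => [|l IHl] j g d lelk ltj ltg ltc dc /=.
  by rewrite dc // witA // ?(leq_trans ltc) //; lia.
have ltc1 : (c < r1 l)%N by apply: leq_trans ltc (ler_r1 _); lia.
have ltj2 := @ltn_children l j _ ltj.
rewrite (bigD1 (Ordinal ltc1)) //= big1 ?addr0 => [|a /negPf ac].
  rewrite !IHl ?eqxx ?mulr1 //; try lia.
  - by rewrite witA //; [rewrite /witness lelk | lia].
  - by move=> i ltil; apply: dc; rewrite expnS; lia.
  - by move=> i ltil; apply: dc; rewrite expnS; lia.
rewrite (IHl _ _ d) //; try lia; last by move=> i ltil; apply: dc; rewrite expnS; lia.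
have -> : (a == c :> nat) = false by rewrite -[RHS]ac.
by rewrite mulr0 mul0r.
Qed.

(** All-one weights yield an identity matrix: the sum over [a] of [[a = c] [a = c']] is
    [[c = c']]. *)
Lemma phi_witness_mid j d c c' : (j < n)%N -> (c < r)%N -> (c' < r)%N ->
  (forall i, (i < 2 ^ k)%N -> d i = c) ->
  (forall i, (i < 2 ^ k)%N -> d (i + 2 ^ k)%N = c') ->
  phi A r1 k.+1 j 0 d = (c == c')%:R.
Proof.
move=> ltj ltc ltc' dc dc' /=; have ltj2 := @ltn_children k j _ ltj.
have ltc1 : (c < r1 k)%N by apply: leq_trans ltc (ler_r1 _).
have term (a : 'I_(r1 k)) : A k.+1 j 0%N a * phi A r1 k (2 * j) a d
    * phi A r1 k (2 * j).+1 a (fun i => d (i + 2 ^ k)%N) = (a == c :> nat)%:R * (a == c' :> nat)%:R.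
  rewrite (phi_witness_low (c := c)) ?(phi_witness_low (c := c')) //; try lia.
  by rewrite witA ?r1_gt0 // /witness ltnn eqxx mul1r.
rewrite (eq_bigr _ (fun a _ => term a)) (bigD1 (Ordinal ltc1)) //= eqxx mul1r.
by rewrite big1 ?addr0 // => a /negPf ac; rewrite -val_eqE /= in ac; rewrite ac mul0r.
Qed.

(** Above level [k.+1] only index 0 has nonzero weight, so a node is the product of its two children
    and tests [u = v] on all blocks below it. *)
Lemma phi_witness_high (u v : 'I_n -> 'I_M) m j :
  (forall q, (u q < r)%N) -> (forall q, (v q < r)%N) ->
  (k.+1 + m < L1)%N -> (j < 2 ^ (L - (k.+1 + m)))%N ->
  phi A r1 (k.+1 + m) j 0 (fun i => ext (mix u v) (j * 2 ^ (k.+1 + m) + i)%N)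
    = [forall q : 'I_n, (q %/ 2 ^ m == j)%N ==> (u q == v q)]%:R.
Proof.
move=> ltu ltv; elim: m j => [|m IHm] j ltm ltj.
  rewrite addn0 in ltj *; have d_half (b : bool) i : (i < 2 ^ k)%N ->
      ext (mix u v) (j * 2 ^ k.+1 + (b * 2 ^ k + i)) = if b then v (Ordinal ltj) else u (Ordinal ltj).
    move=> ltik; rewrite -(ext_mix u v (Ordinal ltj) b ltik); congr (ext _ _).
    by rewrite /= expnS; case: b; lia.
  rewrite (@phi_witness_mid _ _ (u (Ordinal ltj)) (v (Ordinal ltj))) //.
  - congr (nat_of_bool _)%:R; apply/eqP/forallP => [uv q|/(_ (Ordinal ltj))].
      apply/implyP; rewrite expn0 divn1 => /eqP qj; apply/eqP/val_inj.
      by rewrite (_ : q = Ordinal ltj) //; apply: val_inj.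
    by rewrite expn0 divn1 eqxx /= => /eqP ->.
  - by move=> i ltik; rewrite (d_half false).
  - by move=> i ltik; rewrite [(i + _)%N]addnC -[(2 ^ k)%N]mul1n (d_half true).
rewrite addnS in ltm ltj *; have ltj2 := ltn_children ltm ltj.
have r0 : (0 < r1 (k.+1 + m))%N by apply: r1_gt0; lia.
have top_wit (a : 'I_(r1 (k.+1 + m))) : A (k.+1 + m).+1 j 0%N a = (a == 0%N :> nat)%:R.
  by rewrite witA ?r1_gt0 // witness_high //; lia.
rewrite phiS (bigD1 (Ordinal r0)) // big1 ?Monoid.mulm1 => [|a]; last first.
  by rewrite -val_eqE /= => /negPf a0; rewrite top_wit a0 !mul0r.
rewrite top_wit eqxx mul1r.
have eqd b i : (j * 2 ^ (k.+1 + m).+1 + (i + b * 2 ^ (k.+1 + m)) = (b + 2 * j) * 2 ^ (k.+1 + m) + i)%N.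
  by rewrite expnS; lia.
rewrite (@eq_phi _ _ _ _ _ _ (fun i => ext (mix u v) ((2 * j) * 2 ^ (k.+1 + m) + i)%N)); last first.
  by move=> i _; rewrite -(eqd 0%N) addn0.
rewrite (@eq_phi _ _ _ (2 * j).+1 _ _ (fun i => ext (mix u v) ((2 * j).+1 * 2 ^ (k.+1 + m) + i)%N)); last first.
  by move=> i _; rewrite -(eqd 1%N) mul1n.
rewrite !IHm //; try lia.
rewrite -natrM mulnb; congr (nat_of_bool _)%:R.
(* The blocks below node [j] are those below its children [2 * j] and [(2 * j).+1]. *)
have split q : (q %/ 2 ^ m.+1 == j)%N = (q %/ 2 ^ m == 2 * j)%N || (q %/ 2 ^ m == (2 * j).+1)%N.
  rewrite expnSr divnMA; lia.
apply/andP/forallP => [[/forallP h0 /forallP h1] q|h].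
  by rewrite split; apply/implyP => /orP [] qj; [apply: (implyP (h0 q))|apply: (implyP (h1 q))].
by split; apply/forallP => q; apply/implyP => qj; apply: (implyP (h q)); rewrite split qj ?orbT.
Qed.

(** The top vector also keeps only index 0, and each block lies below exactly one top node, so the
    product of their tests compares [u] and [v] everywhere. *)
Lemma gen_tensor_witness (u v : 'I_n -> 'I_M) :
  (forall q, (u q < r)%N) -> (forall q, (v q < r)%N) ->
  @gen_tensor R A r1 L M L1 (mix u v) = [forall q, u q == v q]%:R.
Proof.
move=> ltu ltv; rewrite /gen_tensor.
have r0 : (0 < r1 L1.-1)%N by apply: r1_gt0; lia.
have witL1 a : witness L1 0 a = (a == 0%N)%:R by apply: witness_high.
rewrite (bigD1 (Ordinal r0)) //= [X in _ + X]big1 ?addr0 => [|a]; last first.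
  by rewrite -val_eqE /= => /negPf a0; rewrite witA_top // witL1 a0 mul0r.
rewrite witA_top // witL1 eqxx mul1r.
pose m := (L1.-1 - k.+1)%N; have defL1 : (L1.-1 = k.+1 + m)%N by lia.
have defN : (L - L1 + 1 = L - (k.+1 + m))%N by lia.
rewrite defL1 (eq_bigr (fun j : 'I__ => [forall q : 'I_n, (q %/ 2 ^ m == j)%N ==> (u q == v q)]%:R)).
  case: (boolP [forall q, u q == v q]) => [/forallP uv|/forallPn [q uvq]].
    by rewrite big1 // => j _; case: forallP => // -[] q; rewrite uv implybT.
  have ltq : (q %/ 2 ^ m < 2 ^ (L - L1 + 1))%N.
    rewrite ltn_divLR ?expn_gt0 // -expnD; apply: leq_trans (ltn_ord q) _.
    by rewrite leq_exp2l //; lia.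
  rewrite (bigD1 (Ordinal ltq)) //=; case: forallP => [/(_ q)|_]; last by rewrite mul0r.
  by rewrite eqxx (negPf uvq).
move=> j _; apply: phi_witness_high => //; first by lia.
by rewrite -defN.
Qed.

End Witness.
End Matricization.

(** * Reading parameters of a configuration, and nullity of the bad set *)

(** An address is determined by its coordinates, so the sum defining [param] has a single term. *)
Lemma param_of_coords shared L M L1 r1 (w : nat -> nat -> nat -> nat -> R) l j g a :
  let j' := if shared then 0%N else j in
  (l < L1.+1)%N -> (j' < 2 ^ L)%N -> (g < bnd M L1 r1)%N -> (a < bnd M L1 r1)%N ->
  valid shared L M L1 r1 l j' g a ->
  param (fun p : Pidx shared L M L1 r1 =>
           let: (l, j, g, a) := coords (val p) in w l j g a) l j g a = w l j' g a.
Proof.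
move=> j' ltl ltj ltg lta vx.
pose x : 'I_L1.+1 * 'I_(2 ^ L) * 'I_(bnd M L1 r1) * 'I_(bnd M L1 r1) :=
  (Ordinal ltl, Ordinal ltj, Ordinal ltg, Ordinal lta).
have vpx : vpred shared x by [].
rewrite /param (big_pred1 (Sub x vpx : Pidx shared L M L1 r1)) ?SubK //= => p.
rewrite [RHS](_ : _ = (val p == x)) //; case: p => -[[[l1 j1] g1] a1] /= _.
by rewrite -/j' !xpair_eqE.
Qed.

Lemma bnd_gt M L1 r1 : (M < bnd M L1 r1)%N.
Proof. by rewrite ltnS leq_maxl. Qed.

Lemma bnd_gt_rank M L1 r1 l : (l < L1)%N -> (r1 l < bnd M L1 r1)%N.
Proof.
move=> ltl; rewrite ltnS leq_max; apply/orP; right.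
exact: (@leq_bigmax _ (fun l : 'I_L1 => r1 l) (Ordinal ltl)).
Qed.

Lemma geq_min_rank r1 k M l : (l < k)%N -> (min_rank r1 k M <= r1 l)%N.
Proof.
move=> ltlk; rewrite /min_rank; have := mem_index_enum (Ordinal ltlk).
elim: index_enum => // i s IHs; rewrite in_cons big_cons geq_min.
by case/predU1P=> [<-|/IHs ->]; rewrite ?leqnn ?orbT.
Qed.

Lemma geq_min_rank_dim r1 k M : (min_rank r1 k M <= M)%N.
Proof. by rewrite /min_rank; elim/big_rec: _ => // i x _; apply/leq_trans/geq_minr. Qed.

Lemma bad_set_null shared L M L1 L2 r1 :
  (L1 <= L)%N -> (L2 < L1)%N -> (1 <= L2)%N ->
  (forall l, (l < L1)%N -> (0 < r1 l)%N) ->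
  lebesgue_null (@bad_set R shared L M L1 L2 r1).
Proof.
case: L2 => // k leL1L ltkL1 _ r1_gt0.
set r := min_rank r1 k.+1 M; have ltkL : (k < L)%N by lia.
(* Rows and columns are indexed by functions from blocks to ['I_r], so the minor has size
   [r ^ (2 ^ (L - k.+1))], the bound on [r2 k] in [bad_set]. *)
pose n := (2 ^ (L - k.+1))%N; pose T := {ffun 'I_n -> 'I_r}.
have lerM : (r <= M)%N by apply: geq_min_rank_dim.
pose row_index (f : 'I_#|T|) (q : 'I_n) := widen_ord lerM ((enum_val f : T) q).
pose X (theta : Pidx shared L M L1 r1 -> R) :=
  \matrix_(f < #|T|, g < #|T|) hdt theta (mix ltkL (row_index f) (row_index g)).
apply: (@sub_lebesgue_null _ _ _ (fun theta => \det (X theta) = 0)).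
  move=> theta [r2 [_ [ltr2 [theta2 eq2]]]].
  have ltT : (r2 k < #|T|)%N by rewrite card_ffun !card_ord.
  rewrite -(det_matricization_eq0 ltkL (param theta2) row_index ltT); congr (\det _).
  by apply/matrixP => f g; rewrite !mxE -eq2.
(* The node index [j] is ignored, so the same values serve the shared and the unshared variant. *)
pose theta0 (p : Pidx shared L M L1 r1) : R :=
  let: (l, j, g, a) := coords (val p) in witness k l g a.
have ltrk l a : (l < L1)%N -> (a < r1 l)%N -> (a < bnd M L1 r1)%N.
  by move=> ltl lta; apply: ltn_trans lta (bnd_gt_rank _ _ ltl).
have L1_neq0 : L1 != 0%N by lia.
have rt_gt0 : (0 < r1 L1.-1)%N by apply: r1_gt0; lia.
(* The null set lemmas ask for a coordinate; entry 0 of the top vector exists because [r1 L1.-1] is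
   positive. *)
have p0 : Pidx shared L M L1 r1.
  have z : (0 < bnd M L1 r1)%N by [].
  have z2 : (0 < 2 ^ L)%N by rewrite expn_gt0.
  exists (ord_max, Ordinal z2, Ordinal z, Ordinal z).
  by rewrite /vpred /= /valid ltnn (negPf L1_neq0) eqxx.
apply: (@null_polyfun_zeros R _ (fun theta => \det (X theta)) p0 theta0).
  apply: polyfun_det => f g; have [e he] := @polyfun_hdt shared L M L1 r1 (mix ltkL (row_index f) (row_index g)).
  by exists e => theta; rewrite he mxE.
suff -> : X theta0 = 1%:M by rewrite det1 oner_eq0.
apply/matrixP => f g; rewrite !mxE.
rewrite /hdt (@gen_tensor_witness L k ltkL _ M L1 r r1) //.
- congr (nat_of_bool _)%:R; apply/forallP/eqP => [fg|-> //].
  apply: enum_val_inj; apply/ffunP => q; apply: val_inj.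
  by have /eqP/(congr1 val) := fg q.
- by move=> l lelk; apply: geq_min_rank.
- move=> l j g' a ltl ltj ltg lta.
  rewrite (@param_of_coords shared L M L1 r1 (fun l j => witness k l)) //.
  + by lia.
  + case: (shared) => //; first by rewrite expn_gt0.
    by apply: leq_trans ltj _; rewrite leq_exp2l //; lia.
  + exact: ltrk ltg.
  + case: l lta {ltj ltg} ltl => [ltM _|l lta ltl]; first exact: ltn_trans ltM (bnd_gt _ _ _).
    by apply: (ltrk l) => //; lia.
  rewrite /valid; case: l ltl ltj ltg lta => [|l] ltl ltj ltg lta /=.
    by rewrite subn0 in ltj; case: (shared); rewrite /= ?ltj ltg lta.
  by rewrite ltl ltg lta; case: (shared); rewrite //= ltj.
- move=> a lta; rewrite (@param_of_coords shared L M L1 r1 (fun l j => witness k l)) //=.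
  + by case: (shared); rewrite expn_gt0.
  + by apply: ltrk lta; lia.
  by rewrite /valid ltnn (negPf L1_neq0) eqxx lta; case: (shared).
- by move=> q; apply: (ltn_ord ((enum_val f : T) q)).
- by move=> q; apply: (ltn_ord ((enum_val g : T) q)).
Qed.

End Decompositions.

Theorem theorem2 (R : realType) (L M L1 L2 : nat) (r1 : nat -> nat) :
  (L1 <= L)%N -> (L2 < L1)%N -> (1 <= L2)%N ->
  (forall l, (l < L1)%N -> (0 < r1 l)%N) ->
  lebesgue_null (@bad_set R false L M L1 L2 r1) /\
  lebesgue_null (@bad_set R true L M L1 L2 r1).
Proof. by move=> *; split; apply: bad_set_null. Qed.
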